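(* Let $\mathcal{A}\in\mathbb{R}^{n_1\times n_2\times n_3}$, $\mathcal{B}\in\mathbb{R}^{n_1\times p\times n_3}$, let $\mathcal{T}=\{\tau_j\}_{j=1}^q$ be a partition of $[n_2]=\{1,\dots,n_2\}$ into $q$ nonempty disjoint blocks, and let $$\Gamma_1=\max_{\tau_j\in\mathcal{T}}\frac{\|\operatorname{bcirc}(\mathcal{A}_{:,\tau_j,:})\|_2^2}{\|\mathcal{A}_{:,\tau_j,:}\|_F^2}.$$ Assume that $\operatorname{bcirc}(\mathcal{A})$ has full column rank. Let $\mathcal{X}^{(0)}\in\mathbb{R}^{n_2\times p\times n_3}$, let $\{\mathcal{X}^{(k)}\}_{k=0}^\infty$ be the random sequence generated from $\mathcal{X}^{(0)}$ by the tensor randomized average block coordinate descent (tRABCD) method, and put $\mathcal{E}^{(k)}=\mathcal{A}*(\mathcal{X}_{LS}-\mathcal{X}^{(k)})$, where $\mathcal{X}_{LS}$ is the least squares solution of $\mathcal{A}*\mathcal{X}=\mathcal{B}$. Then for every $k\ge 0$, $$\mathbb{E}\|\mathcal{E}^{(k+1)}\|_F^2\le\left(1-\frac{\sigma_{\min}^2(\operatorname{bcirc}(\mathcal{A}))}{\Gamma_1\|\mathcal{A}\|_F^2}\right)^{k+1}\|\mathcal{E}^{(0)}\|_F^2 .$$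
   Context: Tensor notation. For $\mathcal{A}\in\mathbb{R}^{n_1\times n_2\times n_3}$ let $A_1,\dots,A_{n_3}\in\mathbb{R}^{n_1\times n_2}$ be its frontal slices, $A_i=\mathcal{A}_{:,:,i}$. $\operatorname{bcirc}(\mathcal{A})\in\mathbb{R}^{n_1n_3\times n_2n_3}$ is the block circulant matrix whose $(i,j)$ block is $A_{((i-j)\bmod n_3)+1}$; $\operatorname{unfold}(\mathcal{A})\in\mathbb{R}^{n_1n_3\times n_2}$ stacks $A_1,\dots,A_{n_3}$ vertically, and $\operatorname{fold}$ is its inverse. The t-product of $\mathcal{A}\in\mathbb{R}^{n_1\times n_2\times n_3}$ and $\mathcal{C}\in\mathbb{R}^{n_2\times p\times n_3}$ is $\mathcal{A}*\mathcal{C}=\operatorname{fold}(\operatorname{bcirc}(\mathcal{A})\operatorname{unfold}(\mathcal{C}))\in\mathbb{R}^{n_1\times p\times n_3}$. The transpose $\mathcal{A}^T\in\mathbb{R}^{n_2\times n_1\times n_3}$ is obtained by transposing every frontal slice and reversing the order of slices $2,\dots,n_3$, so $\operatorname{bcirc}(\mathcal{A}^T)=\operatorname{bcirc}(\mathcal{A})^T$. $\|\mathcal{A}\|_F^2=\sum_{i,j,l}\mathcal{A}_{i,j,l}^2$. For $\tau\subseteq[n_2]$, $\mathcal{A}_{:,\tau,:}$ is the subtensor of lateral slices with second index in $\tau$, and $\mathcal{X}_{\tau,:,:}$ is the subtensor of $\mathcal{X}\in\mathbb{R}^{n_2\times p\times n_3}$ of horizontal slices with first index in $\tau$. $\|\cdot\|_2$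 is the matrix spectral norm and $\sigma_{\min}$ denotes the smallest singular value of a matrix (here of full column rank, so $\sigma_{\min}(M)=\min_{\|x\|_2=1}\|Mx\|_2$). $\mathcal{X}_{LS}$ is a minimizer of $\|\mathcal{B}-\mathcal{A}*\mathcal{X}\|_F^2$ over $\mathcal{X}\in\mathbb{R}^{n_2\times p\times n_3}$. tRABCD method. Given a deterministic $\mathcal{X}^{(0)}$, set $\mathcal{R}^{(0)}=\mathcal{B}-\mathcal{A}*\mathcal{X}^{(0)}$. For $k=0,1,2,\dots$: sample (independently of previous samples) a block $\tau_{j_k}\in\mathcal{T}$ with probability $\|\mathcal{A}_{:,\tau_{j_k},:}\|_F^2/\|\mathcal{A}\|_F^2$; update only the horizontal slices in the selected block by $$\mathcal{X}^{(k+1)}_{\tau_{j_k},:,:}=\mathcal{X}^{(k)}_{\tau_{j_k},:,:}+\frac{\|(\mathcal{A}_{:,\tau_{j_k},:})^T*\mathcal{R}^{(k)}\|_F^2}{\|\mathcal{A}_{:,\tau_{j_k},:}*(\mathcal{A}_{:,\tau_{j_k},:})^T*\mathcal{R}^{(k)}\|_F^2}\,(\mathcal{A}_{:,\tau_{j_k},:})^T*\mathcal{R}^{(k)},$$ all other horizontal slices being unchanged, and set $\mathcal{R}^{(k+1)}=\mathcal{R}^{(k)}-\mathcal{A}_{:,\tau_{j_k},:}*(\mathcal{X}^{(k+1)}_{\tau_{j_k},:,:}-\mathcal{X}^{(k)}_{\tau_{j_k},:,:})$ (so $\mathcal{R}^{(k)}=\mathcal{B}-\mathcal{A}*\mathcal{X}^{(k)}$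 for all $k$). If $\mathcal{A}_{:,\tau_{j_k},:}*(\mathcal{A}_{:,\tau_{j_k},:})^T*\mathcal{R}^{(k)}=0$, then $\mathcal{X}^{(k+1)}=\mathcal{X}^{(k)}$. The expectation $\mathbb{E}$ is over the random block choices. *)

(* Defs.v *)
From HB Require Import structures.
From mathcomp Require Import all_boot all_order all_algebra.
From mathcomp Require Import all_classical all_reals all_analysis.

Set Implicit Arguments.
Unset Strict Implicit.
Unset Printing Implicit Defensive.

Import Order.TTheory GRing.Theory Num.Theory.
Local Open Scope ring_scope.

(* A third-order tensor is the family of its frontal slices, indexed from 0;
   the lmodType structure (in particular +, - and *:) is that of {ffun _}. *)
Notation tensor R n1 n2 n3 := {ffun 'I_n3 -> 'M[R]_(n1, n2)}.

Section Tensor.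
Variable R : realType.

(* The third dimension is n.+1, so that slice indices form the cyclic group
   Z/(n.+1)Z: below, [i - j] and [- l] are taken modulo n.+1. *)
Definition bcirc n1 n2 n (A : tensor R n1 n2 n.+1) :
    'M[R]_(\sum_(i < n.+1) n1, \sum_(j < n.+1) n2) :=
  \mxblock_(i < n.+1, j < n.+1) A (i - j).

Definition unfold n1 n2 n (A : tensor R n1 n2 n.+1) :
    'M[R]_(\sum_(i < n.+1) n1, n2) :=
  \mxcol_(i < n.+1) A i.

Definition fold n1 n2 n (M : 'M[R]_(\sum_(i < n.+1) n1, n2)) :
    tensor R n1 n2 n.+1 :=
  [ffun i => submxcol M i].

Definition tprod n1 n2 p n (A : tensor R n1 n2 n.+1) (C : tensor R n2 p n.+1) :
    tensor R n1 p n.+1 :=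
  fold (bcirc A *m unfold C).

Definition ttr n1 n2 n (A : tensor R n1 n2 n.+1) : tensor R n2 n1 n.+1 :=
  [ffun l => (A (- l))^T].

(* The square of the Frobenius norm. *)
Definition normF2 n1 n2 n3 (A : tensor R n1 n2 n3) : R :=
  \sum_i \sum_j \sum_l A l i j ^+ 2.

Definition lateral n1 n2 n3 (tau : {set 'I_n2}) (A : tensor R n1 n2 n3) :
    tensor R n1 #|tau| n3 :=
  [ffun l => colsub (fun s : 'I_#|tau| => enum_val s) (A l)].

Definition horizontal n1 n2 n3 (tau : {set 'I_n1}) (X : tensor R n1 n2 n3) :
    tensor R #|tau| n2 n3 :=
  [ffun l => rowsub (fun s : 'I_#|tau| => enum_val s) (X l)].

Definition norm2 m (x : 'cV[R]_m) : R := Num.sqrt (\sum_i x i 0 ^+ 2).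

(* The operator norm induced by the Euclidean norms. *)
Definition spectral_norm m n (M : 'M[R]_(m, n)) : R :=
  sup [set norm2 (M *m x) | x in [set x : 'cV[R]_n | norm2 x = 1]]%classic.

(* An m x n matrix has min(m, n) singular values, counted with multiplicity:
   the square roots of the eigenvalues of the smaller of its Gram matrices. *)
Definition singular_value m n (M : 'M[R]_(m, n)) (s : R) : Prop :=
  0 <= s /\
  (if (n <= m)%N then eigenvalue (M^T *m M) (s ^+ 2)
   else eigenvalue (M *m M^T) (s ^+ 2)).

Definition sigma_min m n (M : 'M[R]_(m, n)) : R :=
  inf [set s | singular_value M s]%classic.

(* The maximum is over nonnegative ratios, so the default value 0 of the
   iterated maximum is immaterial. *)
Definition Gamma1 n1 n2 n q (A : tensor R n1 n2 n.+1)
    (tau : 'I_q -> {set 'I_n2}) : R :=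
  \big[Num.max/0]_(j < q)
    (spectral_norm (bcirc (lateral (tau j) A)) ^+ 2 /
     normF2 (lateral (tau j) A)).

Definition least_squares n1 n2 p n (A : tensor R n1 n2 n.+1)
    (B : tensor R n1 p n.+1) (X : tensor R n2 p n.+1) : Prop :=
  forall Y : tensor R n2 p n.+1,
    normF2 (B - tprod A X) <= normF2 (B - tprod A Y).

(* (X, Res) and (X', Res') are the iterates and residuals before and after
   the update of the block [tau]. *)
Definition tRABCD_step n1 n2 p n (A : tensor R n1 n2 n.+1) (tau : {set 'I_n2})
    (X : tensor R n2 p n.+1) (Res : tensor R n1 p n.+1)
    (X' : tensor R n2 p n.+1) (Res' : tensor R n1 p n.+1) : Prop :=
  let At := lateral tau A in
  let G := tprod (ttr At) Res in
  let H := tprod At G in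
  (if H == 0 then X' = X
   else horizontal tau X' =
          horizontal tau X + (normF2 G / normF2 H) *: G /\
        forall i, i \notin tau -> forall l, row i (X' l) = row i (X l)) /\
  Res' = Res - tprod At (horizontal tau X' - horizontal tau X).

Local Open Scope ereal_scope.

Definition mutually_independent d (Omega : measurableType d)
    (P : probability Omega R) (I : finType) (J : nat -> Omega -> I) : Prop :=
  forall (s : seq nat) (S : nat -> {set I}), uniq s ->
    P (\bigcap_(k in [set` s]) [set w | J k w \in S k])%classic =
    \prod_(k <- s) P [set w | J k w \in S k]%classic.

(* [J k] is the random index of the block selected at iteration k. *)
Record tRABCD n1 n2 p n q (A : tensor R n1 n2 n.+1) (B : tensor R n1 p n.+1)
    (tau : 'I_q -> {set 'I_n2}) (X0 : tensor R n2 p n.+1)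
    d (Omega : measurableType d) (P : probability Omega R)
    (J : nat -> Omega -> 'I_q)
    (X : nat -> Omega -> tensor R n2 p n.+1)
    (Res : nat -> Omega -> tensor R n1 p n.+1) : Prop := {
  tRABCD_measurable : forall k j, measurable [set w | J k w = j]%classic ;
  tRABCD_independent : mutually_independent P J ;
  tRABCD_law : forall k j, P [set w | J k w = j]%classic =
    (normF2 (lateral (tau j) A) / normF2 A)%:E ;
  tRABCD_X0 : forall w, X 0%N w = X0 ;
  tRABCD_Res0 : forall w, Res 0%N w = (B - tprod A X0)%R ;
  tRABCD_iter : forall k w,
    tRABCD_step A (tau (J k w)) (X k w) (Res k w) (X k.+1 w) (Res k.+1 w)
}.

End Tensor.

(* Main.v *)
Require Import Defs.
From mathcomp Require Import all_boot all_order all_algebra.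
From mathcomp Require Import all_classical all_reals all_analysis.
From mathcomp Require Import measurable_realfun ring lra.

Import Order.TTheory GRing.Theory Num.Theory.
Local Open Scope ring_scope.

(** The error [W = X_LS - X] evolves autonomously. By the normal equations,
    [A^T * (B - A * X_LS) = 0], so with [D = A^T * (A * W)] the search direction
    [A_tau^T * R] consists of the horizontal slices of [D] in the block [tau],
    and one update replaces [W] by [error_step A tau W], a function of [tau] and
    [W] alone ([tRABCD_step_error]).

    The step length is that of exact line search: the squared error
    [|A * W|^2] drops by [|D_tau|^4 / |A_tau * D_tau|^2]
    ([normF2_error_step]). The denominator is at most
    [|bcirc A_tau|_2^2 |D_tau|^2], hence at most
    [Gamma1 |A_tau|_F^2 |D_tau|^2], and the block probability
    [|A_tau|_F^2 / |A|_F^2] cancels the factor that depends on the block. The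
    average drop is therefore at least [|D|^2 / (Gamma1 |A|_F^2)], the slices of
    [D] being partitioned by the blocks. Since [A * W] lies in the range of [A],
    [|D|^2 >= sigma_min^2 |A * W|^2] ([sigma_min_trmx_le]), which gives the
    contraction in one step ([expected_contraction]), for every [W].

    A function of the first [k] block indices has as its expectation a finite
    sum over words of length [k], weighted by products of block probabilities
    because the indices are independent ([expectation_history]). Summing over
    the first letter and using the one-step contraction gives the [k]-th power
    of the rate by induction ([expectation_iteration_le]).

    The bound [sigma_min M * |x| <= |M x|] requires an eigenvalue of [M^T M]
    below every Rayleigh quotient ([exists_least_Gram_eigenvalue]). *)

(** * Frobenius inner product and extreme singular values *)

Section Frobenius.
Local Set Implicit Arguments.
Local Unset Strict Implicit.
Local Unset Printing Implicit Defensive.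
Variable R : realType.

Definition fdot m n (U V : 'M[R]_(m, n)) : R := \tr (U^T *m V).
Definition fnorm2 m n (U : 'M[R]_(m, n)) : R := fdot U U.

Lemma fdotE m n (U V : 'M[R]_(m, n)) :
  fdot U V = \sum_i \sum_j U i j * V i j.
Proof.
rewrite exchange_big; apply: eq_bigr => j _; rewrite mxE.
by apply: eq_bigr => i _; rewrite mxE.
Qed.

Lemma fnorm2E m n (U : 'M[R]_(m, n)) :
  fnorm2 U = \sum_i \sum_j U i j ^+ 2.
Proof. exact: fdotE. Qed.

Lemma fdotC m n (U V : 'M[R]_(m, n)) : fdot U V = fdot V U.
Proof. by rewrite /fdot -mxtrace_tr trmx_mul trmxK. Qed.

Lemma fdotDr m n (U V W : 'M[R]_(m, n)) :
  fdot U (V + W) = fdot U V + fdot U W.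
Proof. by rewrite /fdot mulmxDr mxtraceD. Qed.

Lemma fdotZr m n a (U V : 'M[R]_(m, n)) : fdot U (a *: V) = a * fdot U V.
Proof. by rewrite /fdot -scalemxAr mxtraceZ. Qed.

Lemma fdot_mulmxl m n p (M : 'M[R]_(m, n)) (U : 'M[R]_(n, p)) (V : 'M[R]_(m, p)) :
  fdot (M *m U) V = fdot U (M^T *m V).
Proof. by rewrite /fdot trmx_mul mulmxA. Qed.

Lemma fnorm2_ge0 m n (U : 'M[R]_(m, n)) : 0 <= fnorm2 U.
Proof.
rewrite fnorm2E sumr_ge0 // => i _.
by rewrite sumr_ge0// => j _; rewrite sqr_ge0.
Qed.

Lemma fnorm2_eq0 m n (U : 'M[R]_(m, n)) : fnorm2 U = 0 -> U = 0.
Proof.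
rewrite fnorm2E => U0; apply/matrixP => i j; rewrite mxE; apply/eqP.
have sq_ge0 i' : 0 <= \sum_j U i' j ^+ 2.
  by rewrite sumr_ge0// => *; rewrite sqr_ge0.
have row_i0 := @psumr_eq0P _ _ _ _ (fun i' _ => sq_ge0 i') U0 i isT.
have /eqP := @psumr_eq0P _ _ _ _ (fun j' _ => sqr_ge0 (U i j')) row_i0 j isT.
by rewrite sqrf_eq0.
Qed.

(** Nonnegativity of the quadratic at its vertex [- b / c]; when [c = 0] it is
    affine, and nonnegative everywhere only if [b = 0]. *)
Lemma discriminant_le0 (a b c : R) : 0 <= c ->
  (forall t, 0 <= a + 2 * t * b + t ^+ 2 * c) -> b ^+ 2 <= a * c.
Proof.
move=> c_ge0 pos; have [c0|c_neq0] := eqVneq c 0.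
  have [->|b_neq0] := eqVneq b 0; first by rewrite c0 expr0n mulr0.
  have := pos (- (a + 1) / (2 * b)); rewrite c0.
  have -> : a + 2 * (- (a + 1) / (2 * b)) * b
             + (- (a + 1) / (2 * b)) ^+ 2 * 0 = - 1 by field.
  by lra.
have := pos (- b / c).
have -> : a + 2 * (- b / c) * b + (- b / c) ^+ 2 * c = (a * c - b ^+ 2) / c.
  by field.
by rewrite pmulr_lge0 ?invr_gt0 ?lt_def ?c_neq0// subr_ge0.
Qed.

(** Besides the usual case [S = I], this is needed for [S = M^T M - lambda I],
    in the search for a least eigenvalue of [M^T M]. *)
Lemma psd_Cauchy_Schwarz m n (S : 'M[R]_m) (U V : 'M[R]_(m, n)) :
  S^T = S -> (forall W : 'M[R]_(m, n), 0 <= fdot W (S *m W)) ->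
  fdot U (S *m V) ^+ 2 <= fdot U (S *m U) * fdot V (S *m V).
Proof.
move=> S_sym S_ge0; apply: discriminant_le0 => // t.
have := S_ge0 (U + t *: V); rewrite mulmxDr -scalemxAr !fdotDr !fdotZr.
rewrite !(fdotC (U + _)) !fdotDr !fdotZr !fdot_mulmxl S_sym.
rewrite (fdotC V (S *m U)) fdot_mulmxl S_sym => /le_trans; apply.
by rewrite le_eqVlt; apply/orP; left; apply/eqP; ring.
Qed.

Lemma Cauchy_Schwarz m n (U V : 'M[R]_(m, n)) :
  fdot U V ^+ 2 <= fnorm2 U * fnorm2 V.
Proof.
have := @psd_Cauchy_Schwarz _ _ 1%:M U V (trmx1 _ _).
by rewrite !mul1mx; apply => W; rewrite mul1mx fnorm2_ge0.
Qed.

(** Cauchy-Schwarz in each row. It bounds the set whose supremum is the spectral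
    norm, and also the inverse in the eigenvalue argument below. *)
Lemma fnorm2_mulmx_cV m n (M : 'M[R]_(m, n)) (x : 'cV[R]_n) :
  fnorm2 (M *m x) <= fnorm2 M * fnorm2 x.
Proof.
rewrite fnorm2E (fnorm2E M) mulr_suml; apply: ler_sum => i _.
rewrite big_ord1.
have := Cauchy_Schwarz (row i M)^T x.
rewrite /fdot trmxK -row_mul /mxtrace big_ord1 mxE => /le_trans; apply.
suff -> : fnorm2 (row i M)^T = \sum_j M i j ^+ 2 by [].
by rewrite fnorm2E; apply: eq_bigr => j _; rewrite big_ord1 !mxE.
Qed.

Lemma fnorm2_col m n (U : 'M[R]_(m, n)) :
  fnorm2 U = \sum_j fnorm2 (col j U).
Proof.
rewrite fnorm2E exchange_big; apply: eq_bigr => j _.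
by rewrite fnorm2E; apply: eq_bigr => i _; rewrite big_ord1 mxE.
Qed.

Lemma fnorm2Z m n a (U : 'M[R]_(m, n)) : fnorm2 (a *: U) = a ^+ 2 * fnorm2 U.
Proof. by rewrite /fnorm2 fdotZr fdotC fdotZr mulrA. Qed.

Lemma norm2E m (x : 'cV[R]_m) : norm2 x = Num.sqrt (fnorm2 x).
Proof.
rewrite /norm2 fnorm2E; congr Num.sqrt.
by apply: eq_bigr => i _; rewrite big_ord1.
Qed.

(** The smallest eigenvalue is obtained without compactness: with lambda the
    infimum of the Rayleigh quotient, [S := M^T M - lambda I] is positive
    semidefinite, and if it were invertible then Cauchy-Schwarz for [S]
    applied to [x] and [S^-1 x] would bound the Rayleigh quotient away from
    lambda. *)
Lemma exists_least_Gram_eigenvalue m n (M : 'M[R]_(m, n)) : (0 < n)%N ->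
  exists2 l, 0 <= l & eigenvalue (M^T *m M) l /\
    forall x : 'cV[R]_n, l * fnorm2 x <= fnorm2 (M *m x).
Proof.
move=> n_gt0.
pose Q := [set fnorm2 (M *m x) | x in [set x : 'cV[R]_n | fnorm2 x = 1]]%classic.
have Q0 : (Q !=set0)%classic.
  pose e : 'cV[R]_n := delta_mx (Ordinal n_gt0) 0.
  exists (fnorm2 (M *m e)), e => //=.
  rewrite fnorm2E (bigD1 (Ordinal n_gt0))//= [X in _ + X]big1 => [|i ne].
    by rewrite big_ord1 mxE !eqxx expr1n addr0.
  by rewrite big_ord1 mxE (negPf ne) expr0n.
have Qlb : lbound Q 0 by move=> _ [x _ <-]; exact: fnorm2_ge0.
pose l := inf Q.
have lM (x : 'cV[R]_n) : l * fnorm2 x <= fnorm2 (M *m x).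
  have [x0|x_neq0] := eqVneq (fnorm2 x) 0; first by rewrite x0 mulr0 fnorm2_ge0.
  have x_gt0 : 0 < fnorm2 x by rewrite lt_def x_neq0 fnorm2_ge0.
  have c2 : (Num.sqrt (fnorm2 x))^-1 ^+ 2 = (fnorm2 x)^-1.
    by rewrite exprVn sqr_sqrtr // ltW.
  have := @ge_inf _ Q (ex_intro _ 0 Qlb)
    (fnorm2 (M *m ((Num.sqrt (fnorm2 x))^-1 *: x))).
  rewrite -scalemxAr fnorm2Z c2 mulrC ler_pdivlMr//; apply.
  exists ((Num.sqrt (fnorm2 x))^-1 *: x) => /=.
    by rewrite fnorm2Z c2 mulVf.
  by rewrite -scalemxAr fnorm2Z c2 mulrC.
exists l; first exact: lb_le_inf.
split=> //; rewrite /eigenvalue /eigenspace kermx_eq0.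
set S := _ - _; rewrite row_free_unit; apply/negP => S_unit.
have S_sym : S^T = S.
  by rewrite /S linearB /= trmx_mul trmxK tr_scalar_mx.
have SE (x : 'cV[R]_n) : fdot x (S *m x) = fnorm2 (M *m x) - l * fnorm2 x.
  rewrite /S mulmxBl mul_scalar_mx -mulmxA -scaleN1r !fdotDr !fdotZr.
  by rewrite -fdot_mulmxl mulN1r.
(* With [y = S^-1 x], [2 <y, x> <= |y|^2 + |x|^2 <= 2 c] on the unit sphere. *)
pose c := (1 + fnorm2 (invmx S)) / 2.
have c_gt0 : 0 < c by have := fnorm2_ge0 (invmx S); rewrite /c; lra.
suff : l + c^-1 <= l by rewrite gerDl leNgt invr_gt0 c_gt0.
apply: lb_le_inf => // _ [x /= x1 <-].
pose y := invmx S *m x.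
have Sy : S *m y = x by rewrite mulmxA mulmxV// mul1mx.
have := @psd_Cauchy_Schwarz _ _ S x y S_sym _.
rewrite Sy (SE x) -/(fnorm2 x) x1 mulr1 expr1n => /(_ _)-/(_ _)/le_trans.
have xy : fdot y x <= c.
  have := fnorm2_ge0 (y + (-1) *: x); have := fnorm2_mulmx_cV (invmx S) x.
  rewrite -/y /fnorm2 !fdotDr !fdotZr !(fdotC (y + _)) !fdotDr !fdotZr.
  rewrite -!/(fnorm2 _) (fdotC x y) x1 /c; lra.
move=> H; rewrite -lerBrDl.
have /H {}H : (fnorm2 (M *m x) - l) * fdot y x <= (fnorm2 (M *m x) - l) * c.
  by apply: ler_wpM2l => //; have := lM x; rewrite x1; lra.
rewrite -[_^-1]mul1r ler_pdivrMr// H// => W; rewrite SE; have := lM W; lra.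
Qed.

(** An infimum is at most any of its members, so one singular value below every
    Rayleigh quotient is enough. *)
Lemma sigma_min_le m n p (M : 'M[R]_(m, n)) (U : 'M[R]_(n, p)) : (n <= m)%N ->
  sigma_min M ^+ 2 * fnorm2 U <= fnorm2 (M *m U).
Proof.
move=> nm; rewrite (fnorm2_col U) (fnorm2_col (M *m U)) mulr_sumr.
apply: ler_sum => j _; rewrite [col j (M *m U)]colE -mulmxA -colE.
move: (col j U) => x {p j U}.
have [n0|n_gt0] := posnP n.
  rewrite (_ : fnorm2 x = 0) ?mulr0 ?fnorm2_ge0// fnorm2E.
  by subst n; rewrite big_ord0.
have [l l_ge0 [l_eig /(_ x)]] := exists_least_Gram_eigenvalue M n_gt0.
apply: le_trans; apply: ler_wpM2r; first exact: fnorm2_ge0.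
have sl : singular_value M (Num.sqrt l).
  by split; rewrite ?sqrtr_ge0// nm sqr_sqrtr.
have slb : lbound [set s | singular_value M s]%classic 0 by move=> s [].
rewrite -(sqr_sqrtr l_ge0) lerXn2r ?nnegrE ?sqrtr_ge0//.
  by apply: lb_le_inf => //; exists (Num.sqrt l).
by apply: ge_inf => //; exists 0.
Qed.

(** Only the range of [M] is seen by [sigma_min M] through [M^T]:
    [|Mx|^2 = <x, M^T M x> <= |x| |M^T M x|], and [sigma_min M * |x|] is
    at most [|Mx|]. *)
Lemma sigma_min_trmx_le m n p (M : 'M[R]_(m, n)) (U : 'M[R]_(n, p)) :
  (n <= m)%N ->
  sigma_min M ^+ 2 * fnorm2 (M *m U) <= fnorm2 (M^T *m (M *m U)).
Proof.
move=> nm; set V := M *m U.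
have [V0|V_neq0] := eqVneq (fnorm2 V) 0; first by rewrite V0 mulr0 fnorm2_ge0.
have V_gt0 : 0 < fnorm2 V by rewrite lt_def V_neq0 fnorm2_ge0.
rewrite -(ler_pM2r V_gt0).
have := Cauchy_Schwarz U (M^T *m V); rewrite -fdot_mulmxl -/V -/(fnorm2 V).
move=> /(ler_wpM2l (sqr_ge0 (sigma_min M))); rewrite expr2 !mulrA.
move=> /le_trans; apply; rewrite [leRHS]mulrC.
by apply: ler_wpM2r; [exact: fnorm2_ge0|exact: sigma_min_le].
Qed.

Lemma fnorm2_mulmx_le_spectral m n p (M : 'M[R]_(m, n)) (U : 'M[R]_(n, p)) :
  fnorm2 (M *m U) <= spectral_norm M ^+ 2 * fnorm2 U.
Proof.
rewrite (fnorm2_col U) (fnorm2_col (M *m U)) mulr_sumr.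
apply: ler_sum => j _; rewrite [col j (M *m U)]colE -mulmxA -colE.
move: (col j U) => x {p j U}.
have [x0|x_neq0] := eqVneq (fnorm2 x) 0.
  by rewrite x0 mulr0 (fnorm2_eq0 x0) mulmx0 /fnorm2 /fdot mulmx0 mxtrace0.
have x_gt0 : 0 < fnorm2 x by rewrite lt_def x_neq0 fnorm2_ge0.
pose c := (Num.sqrt (fnorm2 x))^-1.
have c2 : c ^+ 2 = (fnorm2 x)^-1 by rewrite exprVn sqr_sqrtr // ltW.
have cx : norm2 (c *: x) = 1 by rewrite norm2E fnorm2Z c2 mulVf// sqrtr1.
have : norm2 (M *m (c *: x)) <= spectral_norm M.
  apply: ub_le_sup; last by exists (c *: x).
  exists (Num.sqrt (fnorm2 M)) => _ [y /= + <-]; rewrite !norm2E => y1.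
  rewrite ler_sqrt ?fnorm2_ge0// (le_trans (fnorm2_mulmx_cV M y))//.
  by rewrite -(sqr_sqrtr (fnorm2_ge0 y)) y1 expr1n mulr1.
rewrite norm2E -scalemxAr fnorm2Z c2 => le_s.
rewrite -ler_pdivrMr// mulrC -[leLHS]sqr_sqrtr; last first.
  by rewrite mulr_ge0 ?invr_ge0 ?fnorm2_ge0.
by rewrite lerXn2r ?nnegrE ?sqrtr_ge0// (le_trans (sqrtr_ge0 _) le_s).
Qed.

End Frobenius.

(** * The t-product under unfolding *)

Section TensorAlgebra.
Local Set Implicit Arguments.
Local Unset Strict Implicit.
Local Unset Printing Implicit Defensive.
Variable R : realType.

Lemma unfold_tprod n1 n2 p n (A : tensor R n1 n2 n.+1) (C : tensor R n2 p n.+1) :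
  unfold (tprod A C) = bcirc A *m unfold C.
Proof.
rewrite /tprod /fold /unfold.
by under eq_mxcol do rewrite ffunE; rewrite submxcolK.
Qed.

Lemma unfold_inj n1 n2 n : injective (@unfold R n1 n2 n).
Proof. by move=> S T /eq_mxcolP eqST; apply/ffunP => i; exact: eqST. Qed.

Lemma unfoldD n1 n2 n (S T : tensor R n1 n2 n.+1) :
  unfold (S + T) = unfold S + unfold T.
Proof. by rewrite /unfold -mxcolD; apply/eq_mxcolP => i; rewrite ffunE. Qed.

Lemma unfoldZ n1 n2 n a (T : tensor R n1 n2 n.+1) :
  unfold (a *: T) = a *: unfold T.
Proof.
apply/mxcolP => i; rewrite mxcolK ffunE -[in LHS](mxcolK T i).
by apply/matrixP => j k; rewrite !mxE.
Qed.

Lemma tprodE n1 n2 p n (A : tensor R n1 n2 n.+1) (C : tensor R n2 p n.+1) i :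
  tprod A C i = \sum_j A (i - j) *m C j.
Proof.
by rewrite ffunE /bcirc mxblockEv mxcol_mul mxcolK mul_mxrow_mxcol.
Qed.

Lemma tprodDr n1 n2 p n (A : tensor R n1 n2 n.+1) (C D : tensor R n2 p n.+1) :
  tprod A (C + D) = tprod A C + tprod A D.
Proof. by apply: unfold_inj; rewrite unfoldD !unfold_tprod unfoldD mulmxDr. Qed.

Lemma tprodZr n1 n2 p n (A : tensor R n1 n2 n.+1) a (C : tensor R n2 p n.+1) :
  tprod A (a *: C) = a *: tprod A C.
Proof. by apply: unfold_inj; rewrite unfoldZ !unfold_tprod unfoldZ -scalemxAr. Qed.

Lemma tprodBr n1 n2 p n (A : tensor R n1 n2 n.+1) (C D : tensor R n2 p n.+1) :
  tprod A (C - D) = tprod A C - tprod A D.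
Proof. by rewrite tprodDr -(scaleN1r D) tprodZr scaleN1r. Qed.

Lemma bcirc_ttr n1 n2 n (A : tensor R n1 n2 n.+1) : bcirc (ttr A) = (bcirc A)^T.
Proof.
rewrite /bcirc tr_mxblock; apply/eq_mxblockP => i j.
by rewrite ffunE opprB.
Qed.

Definition tdot n1 n2 n3 (S T : tensor R n1 n2 n3) : R := \sum_l fdot (S l) (T l).

Lemma tdot_unfold n1 n2 n (S T : tensor R n1 n2 n.+1) :
  tdot S T = fdot (unfold S) (unfold T).
Proof. by rewrite /fdot tr_mxcol mul_mxrow_mxcol raddf_sum. Qed.

Lemma normF2_tdot n1 n2 n3 (T : tensor R n1 n2 n3) : normF2 T = tdot T T.
Proof.
rewrite /tdot; under [RHS]eq_bigr do rewrite fdotE.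
rewrite exchange_big; apply: eq_bigr => i _.
by rewrite exchange_big.
Qed.

Lemma normF2_unfold n1 n2 n (T : tensor R n1 n2 n.+1) :
  normF2 T = fnorm2 (unfold T).
Proof. by rewrite normF2_tdot tdot_unfold. Qed.

Lemma normF2_ge0 n1 n2 n3 (T : tensor R n1 n2 n3) : 0 <= normF2 T.
Proof. by rewrite normF2_tdot sumr_ge0// => l _; exact: fnorm2_ge0. Qed.

Lemma normF2_eq0 n1 n2 n3 (T : tensor R n1 n2 n3) : normF2 T = 0 -> T = 0.
Proof.
rewrite normF2_tdot => T0; apply/ffunP => l; rewrite ffunE; apply: fnorm2_eq0.
exact: (@psumr_eq0P _ _ _ _ (fun l' _ => fnorm2_ge0 (T l')) T0 l isT).
Qed.

Lemma normF2_0 n1 n2 n3 : normF2 (0 : tensor R n1 n2 n3) = 0.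
Proof.
rewrite /normF2 big1// => i _; rewrite big1// => j _.
by rewrite big1// => l _; rewrite ffunE mxE expr0n.
Qed.

Lemma tdot_tprodl n1 n2 p n (A : tensor R n1 n2 n.+1)
    (C : tensor R n2 p n.+1) (T : tensor R n1 p n.+1) :
  tdot (tprod A C) T = tdot C (tprod (ttr A) T).
Proof. by rewrite !tdot_unfold !unfold_tprod bcirc_ttr fdot_mulmxl. Qed.

Lemma normF2BZ n1 n2 n (S T : tensor R n1 n2 n.+1) a :
  normF2 (S - a *: T) = normF2 S - 2 * a * tdot S T + a ^+ 2 * normF2 T.
Proof.
rewrite !normF2_unfold tdot_unfold -scaleNr unfoldD unfoldZ /fnorm2.
rewrite !fdotDr !fdotZr !(fdotC (_ + _)) !fdotDr !fdotZr (fdotC (unfold T) (unfold S)).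
by ring.
Qed.

(** The first variation of the least squares objective along
    [D := A^T * (B - A * X)] is [-2 |D|^2], so minimality forces [D = 0]. *)
Lemma normal_equations n1 n2 p n (A : tensor R n1 n2 n.+1)
    (B : tensor R n1 p n.+1) (X : tensor R n2 p n.+1) :
  least_squares A B X -> tprod (ttr A) (B - tprod A X) = 0.
Proof.
move=> X_min; set r := B - _; set D := tprod _ _; apply: normF2_eq0.
suff : (- normF2 D) ^+ 2 <= 0 * normF2 (tprod A D).
  by rewrite mul0r sqrrN => D2; apply/eqP; rewrite -sqrf_eq0 eq_le D2 sqr_ge0.
apply: discriminant_le0 => [|t]; first exact: normF2_ge0.
have := X_min (X + t *: D); rewrite tprodDr tprodZr opprD addrA -/r normF2BZ.
suff -> : tdot r (tprod A D) = normF2 D by lra.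
rewrite normF2_tdot {2}/D -tdot_tprodl; apply: eq_bigr => l _; exact: fdotC.
Qed.

(** * Blocks of lateral and horizontal slices *)

(** Zero-padding the block keeps all the tensors at their full size, so that the
    error can be treated without the index types ['I_#|tau|]. *)
Definition mask n1 n2 n3 (tau : {set 'I_n1}) (Y : tensor R n1 n2 n3) :
    tensor R n1 n2 n3 :=
  [ffun l => \matrix_(i, j) (if i \in tau then Y l i j else 0)].

Lemma tprod_lateral n1 n2 p n (tau : {set 'I_n2}) (A : tensor R n1 n2 n.+1)
    (Y : tensor R n2 p n.+1) :
  tprod (lateral tau A) (horizontal tau Y) = tprod A (mask tau Y).
Proof.
apply/ffunP => i; rewrite !tprodE; apply: eq_bigr => j _.
apply/matrixP => a b; rewrite !ffunE !mxE.
transitivity (\sum_(k in tau) A (i - j) a k * Y j k b).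
  by rewrite [RHS]big_enum_val; apply: eq_bigr => k _; rewrite !mxE.
rewrite big_mkcond; apply: eq_bigr => k _; rewrite mxE.
by case: ifP => //; rewrite mulr0.
Qed.

Lemma tprod_ttr_lateral n1 n2 p n (tau : {set 'I_n2}) (A : tensor R n1 n2 n.+1)
    (T : tensor R n1 p n.+1) :
  tprod (ttr (lateral tau A)) T = horizontal tau (tprod (ttr A) T).
Proof.
apply/ffunP => i; rewrite [RHS]ffunE !tprodE.
apply/matrixP => a b; rewrite mxE !summxE; apply: eq_bigr => j _.
by rewrite !ffunE !mxE; apply: eq_bigr => k _; rewrite !mxE.
Qed.

Lemma normF2_horizontal n1 n2 n3 (tau : {set 'I_n1}) (T : tensor R n1 n2 n3) :
  normF2 (horizontal tau T) = \sum_(i in tau) \sum_j \sum_l T l i j ^+ 2.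
Proof.
rewrite [RHS]big_enum_val; apply: eq_bigr => i _; apply: eq_bigr => j _.
by apply: eq_bigr => l _; rewrite ffunE mxE.
Qed.

Lemma normF2_lateral n1 n2 n3 (tau : {set 'I_n2}) (T : tensor R n1 n2 n3) :
  normF2 (lateral tau T) = \sum_(j in tau) \sum_i \sum_l T l i j ^+ 2.
Proof.
rewrite [LHS]exchange_big [RHS]big_enum_val.
apply: eq_bigr => j _; apply: eq_bigr => i _.
by apply: eq_bigr => l _; rewrite ffunE mxE.
Qed.

Section Partition.
Variables (n2 q : nat) (tau : 'I_q -> {set 'I_n2}).
Hypothesis tau_disjoint : forall i j, i != j -> [disjoint tau i & tau j].
Hypothesis tau_cover : (\bigcup_(j < q) tau j)%SET = [set: 'I_n2]%SET.

Lemma sum_blocks (F : 'I_n2 -> R) : \sum_j \sum_(i in tau j) F i = \sum_i F i.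
Proof.
rewrite -partition_disjoint_bigcup// tau_cover.
by apply: eq_bigl => i; rewrite finset.in_setT.
Qed.

Lemma sum_normF2_horizontal p n3 (T : tensor R n2 p n3) :
  \sum_j normF2 (horizontal (tau j) T) = normF2 T.
Proof. by under eq_bigr do rewrite normF2_horizontal; rewrite sum_blocks. Qed.

Lemma sum_normF2_lateral n1 n3 (T : tensor R n1 n2 n3) :
  \sum_j normF2 (lateral (tau j) T) = normF2 T.
Proof.
under eq_bigr do rewrite normF2_lateral.
by rewrite sum_blocks exchange_big.
Qed.

End Partition.

(** * The error iteration *)

Definition normal_map n1 n2 p n (A : tensor R n1 n2 n.+1)
    (W : tensor R n2 p n.+1) : tensor R n2 p n.+1 := tprod (ttr A) (tprod A W).

(** The block update seen on the error [W = X_LS - X]: by the normal equations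
    [A_tau^T * R = A_tau^T * (A * W)], so neither [B] nor [X_LS] occurs. When
    [A_tau * A_tau^T * R = 0] the division by [0] yields [0], and [W] is left
    unchanged. *)
Definition error_step n1 n2 p n (A : tensor R n1 n2 n.+1) (tau : {set 'I_n2})
    (W : tensor R n2 p n.+1) : tensor R n2 p n.+1 :=
  let D := normal_map A W in
  W - (normF2 (horizontal tau D) / normF2 (tprod A (mask tau D))) *: mask tau D.

Lemma tRABCD_step_error n1 n2 p n (A : tensor R n1 n2 n.+1)
    (B : tensor R n1 p n.+1) (XLS : tensor R n2 p n.+1) (tau : {set 'I_n2})
    X Res X' Res' :
  least_squares A B XLS ->
  Res = B - tprod A X -> tRABCD_step A tau X Res X' Res' ->
  Res' = B - tprod A X' /\ XLS - X' = error_step A tau (XLS - X).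
Proof.
move=> /normal_equations XLS_min ->; rewrite /tRABCD_step /error_step.
set D := normal_map A (XLS - X).
have -> : tprod (ttr (lateral tau A)) (B - tprod A X) = horizontal tau D.
  rewrite tprod_ttr_lateral; congr horizontal.
  rewrite -[LHS]subr0 -XLS_min -tprodBr /D /normal_map.
  rewrite [tprod A (XLS - X)]tprodBr; congr tprod.
  by rewrite opprB addrC addrA subrK.
rewrite tprod_lateral /=; move: D => D [X'E ->].
have -> : X' = X + (normF2 (horizontal tau D) / normF2 (tprod A (mask tau D)))
                     *: mask tau D.
  move: X'E; case: ifP => [/eqP -> ->|_ [hX' rX']].
    by rewrite normF2_0 invr0 mulr0 scale0r addr0.
  apply/ffunP => l; apply/matrixP => i j; rewrite !ffunE !mxE.
  have [itau|/rX'/(_ l)/rowP/(_ j)] := boolP (i \in tau); last first.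
    by rewrite !mxE mulr0 addr0.
  move/ffunP/(_ l)/matrixP/(_ (enum_rank_in itau i) j) : hX'.
  by rewrite !ffunE !mxE enum_rankK_in.
split; last by rewrite opprD addrA.
set a := _ / _; rewrite tprodDr tprodZr opprD addrA; congr (_ - _).
rewrite -tprod_lateral -tprodZr; congr tprod.
apply/ffunP => l; apply/matrixP => i j.
by rewrite !ffunE !mxE enum_valP addrAC subrr add0r.
Qed.

(** Exact line search along [G = A_tau^T * E], where [E = A * W]: the linear term
    is [<E, A_tau * G> = |G|^2], so the step [|G|^2 / |A_tau * G|^2] is the
    minimizer of the quadratic. *)
Lemma normF2_error_step n1 n2 p n (A : tensor R n1 n2 n.+1)
    (tau : {set 'I_n2}) (W : tensor R n2 p n.+1) :
  normF2 (tprod A (error_step A tau W)) = normF2 (tprod A W)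
    - normF2 (horizontal tau (normal_map A W)) ^+ 2
      / normF2 (tprod A (mask tau (normal_map A W))).
Proof.
set D := normal_map A W; rewrite /error_step -/D tprodBr tprodZr normF2BZ.
rewrite -[in tdot _ _]tprod_lateral.
have -> : tdot (tprod A W) (tprod (lateral tau A) (horizontal tau D))
          = normF2 (horizontal tau D).
  rewrite normF2_tdot {1}/D /normal_map -tprod_ttr_lateral -tdot_tprodl /tdot.
  by apply: eq_bigr => l _; exact: fdotC.
set g := normF2 (horizontal _ _); set h := normF2 (tprod A (mask _ _)).
have [->|h_neq0] := eqVneq h 0; last by field.
by rewrite invr0; ring.
Qed.

Section Contraction.
Variables (n1 n2 p n q : nat) (A : tensor R n1 n2 n.+1).
Variable tau : 'I_q -> {set 'I_n2}.
Hypothesis tau_disjoint : forall i j, i != j -> [disjoint tau i & tau j].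
Hypothesis tau_cover : (\bigcup_(j < q) tau j)%SET = [set: 'I_n2]%SET.
Implicit Type W : tensor R n2 p n.+1.

Let prob j := normF2 (lateral (tau j) A) / normF2 A.

(** The drop of the squared error in one block, weighted by the probability of
    the block, has a lower bound whose denominator is the same for all blocks,
    so that these bounds can be summed. *)
Lemma block_descent W j :
  normF2 (horizontal (tau j) (normal_map A W)) / (Gamma1 A tau * normF2 A) <=
  prob j * (normF2 (tprod A W) - normF2 (tprod A (error_step A (tau j) W))).
Proof.
set D := normal_map A W; rewrite /prob normF2_error_step -/D.
rewrite opprB addrC subrK -tprod_lateral.
set N := normF2 (lateral _ _); set g := normF2 (horizontal _ _).
set h := normF2 (tprod _ _).
have g_ge0 : 0 <= g by exact: normF2_ge0.
have N_ge0 : 0 <= N by exact: normF2_ge0.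
have NA_ge0 : 0 <= normF2 A by exact: normF2_ge0.
have Gamma_ge : spectral_norm (bcirc (lateral (tau j) A)) ^+ 2 / N <= Gamma1 A tau.
  rewrite /Gamma1 /N; exact: (le_bigmax_cond _ (fun j => _)).
have Gamma_ge0 : 0 <= Gamma1 A tau.
  by apply: le_trans Gamma_ge; rewrite mulr_ge0 ?sqr_ge0 ?invr_ge0.
have h_le : h <= spectral_norm (bcirc (lateral (tau j) A)) ^+ 2 * g.
  by rewrite /h /g !normF2_unfold unfold_tprod; exact: fnorm2_mulmx_le_spectral.
(* [h = 0] forces [g = 0], as [g = <A * W, A_tau * D_tau>]. *)
have [h0|h_neq0] := eqVneq h 0.
  suff -> : g = 0 by rewrite mul0r expr0n mul0r mulr0.
  have := tdot_tprodl (lateral (tau j) A) (horizontal (tau j) D) (tprod A W).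
  rewrite tprod_ttr_lateral -/(normal_map A W) -/D -normF2_tdot -/g.
  rewrite (normF2_eq0 h0) => <-.
  by rewrite /tdot big1// => l _; rewrite ffunE fdotC /fdot mulmx0 mxtrace0.
have h_gt0 : 0 < h by rewrite lt_def h_neq0 normF2_ge0.
have N_gt0 : 0 < N.
  rewrite lt_def N_ge0 andbT; apply: contra_neq h_neq0 => N0.
  rewrite /h (normF2_eq0 N0); apply: etrans (normF2_0 _ _ _).
  congr normF2; apply/ffunP => i; rewrite tprodE ffunE big1// => l _.
  by rewrite ffunE mul0mx.
have Gg : h <= Gamma1 A tau * N * g.
  apply: le_trans h_le _; apply: ler_wpM2r => //.
  by rewrite -ler_pdivrMr.
have [g0|g_neq0] := eqVneq g 0.
  by move: Gg; rewrite g0 mulr0 leNgt h_gt0.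
have g_gt0 : 0 < g by rewrite lt_def g_neq0.
have Gamma_gt0 : 0 < Gamma1 A tau.
  rewrite lt_def Gamma_ge0 andbT; apply/eqP => G0.
  by move: Gg; rewrite G0 !mul0r leNgt h_gt0.
have -> : N / normF2 A * (g ^+ 2 / h) = (N * g ^+ 2 / h) / normF2 A.
  by rewrite mulrAC !mulrA.
rewrite invfM mulrA; apply: ler_wpM2r; first by rewrite invr_ge0.
rewrite ler_pdivlMr// mulrAC ler_pdivrMr//.
have := ler_wpM2l g_ge0 Gg; lra.
Qed.

(** The bounds of [block_descent] add up to [|D|^2 / (Gamma1 |A|_F^2)] because
    the blocks partition the slices of [D = A^T * (A * W)]. All [W] are
    covered, so that the bound can be applied again after each step. *)
Lemma expected_contraction W : (n2 <= n1)%N ->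
  \sum_j prob j * normF2 (tprod A (error_step A (tau j) W)) <=
  (1 - sigma_min (bcirc A) ^+ 2 / (Gamma1 A tau * normF2 A)) *
  normF2 (tprod A W).
Proof.
move=> n2_le; set D := normal_map A W.
have Gamma_ge0 : 0 <= Gamma1 A tau by exact: bigmax_ge_id.
have prob_le1 : \sum_j prob j <= 1.
  rewrite -mulr_suml sum_normF2_lateral//.
  by have [->|?] := eqVneq (normF2 A) 0; rewrite ?mul0r// divff.
have sigma_le : sigma_min (bcirc A) ^+ 2 * normF2 (tprod A W) <= normF2 D.
  rewrite !normF2_unfold /D /normal_map !unfold_tprod bcirc_ttr.
  apply: sigma_min_trmx_le.
  by rewrite !sum_nat_const leq_mul2l n2_le orbT.
have : \sum_j normF2 (horizontal (tau j) D) / (Gamma1 A tau * normF2 A) <=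
  \sum_j prob j * (normF2 (tprod A W) - normF2 (tprod A (error_step A (tau j) W))).
  by apply: ler_sum => j _; exact: block_descent.
rewrite -mulr_suml sum_normF2_horizontal//.
under [X in _ <= X -> _]eq_bigr do rewrite mulrBr.
rewrite sumrB -mulr_suml => descent.
have := ler_wpM2r (normF2_ge0 (tprod A W)) prob_le1.
have : sigma_min (bcirc A) ^+ 2 / (Gamma1 A tau * normF2 A) * normF2 (tprod A W)
       <= normF2 D / (Gamma1 A tau * normF2 A).
  rewrite mulrAC; apply: ler_wpM2r sigma_le.
  by rewrite invr_ge0 mulr_ge0 ?normF2_ge0.
lra.
Qed.

End Contraction.
End TensorAlgebra.

(** * Iterations driven by independent random indices *)

Section RandomIteration.
Local Set Implicit Arguments.
Local Unset Strict Implicit.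
Local Unset Printing Implicit Defensive.
Variables (R : realType) (d : measure_display) (Omega : measurableType d).
Variables (P : probability Omega R) (I : finType) (J : nat -> Omega -> I).
Variable prob : I -> R.
Hypothesis J_measurable : forall k j, measurable [set w | J k w = j]%classic.
Hypothesis J_independent : mutually_independent P J.
Hypothesis J_law : forall k j, P [set w | J k w = j]%classic = (prob j)%:E.

Definition history k w : k.-tuple I := [tuple J i w | i < k].

Lemma history_eqP k (t : k.-tuple I) (j0 : I) w :
  history k w = t <-> forall i, (i < k)%N -> J i w = nth j0 t i.
Proof.
split=> [<- i ik|Jt]; first by rewrite (nth_mktuple _ _ (Ordinal ik)).
by apply/eq_from_tnth => i; rewrite tnth_mktuple Jt// -tnth_nth.
Qed.

(** The default value [j0] of [nth] is never reached, the indices being below the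
    length of [t]. *)
Lemma history_cylinder k (t : k.-tuple I) (j0 : I) :
  [set w | history k w = t]%classic =
  (\bigcap_(i in [set` iota 0 k])
     [set w | J i w \in [set nth j0 t i]%SET])%classic.
Proof.
apply/seteqP; split=> w /=; rewrite (history_eqP t j0) => H i.
  by rewrite /= mem_iota add0n => /andP[_ ik]; rewrite /= H// inE.
move=> ik; have : i \in iota 0 k by rewrite mem_iota add0n.
by move=> /(H i) /=; rewrite inE => /eqP.
Qed.

Lemma measurable_history k (t : k.-tuple I) :
  measurable [set w | history k w = t]%classic.
Proof.
have -> : [set w | history k w = t]%classic =
    (\bigcap_(i in [set` 'I_k]) [set w | J i w = tnth t i])%classic.
  apply/seteqP; split=> w /= => [<- i _|Jt]; first by rewrite tnth_mktuple.
  by apply/eq_from_tnth => i; rewrite tnth_mktuple Jt.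
apply: fin_bigcap_measurable => // i _; exact: J_measurable.
Qed.

Lemma history_law k (t : k.-tuple I) :
  P [set w | history k w = t]%classic = (\prod_(j <- t) prob j)%:E.
Proof.
case: k t => [t|k t].
  rewrite tuple0 big_nil -(@probability_setT _ _ _ P); congr (P _).
  by apply/seteqP; split=> w //= _; exact: tuple0.
pose j0 := thead t; rewrite (history_cylinder t j0).
rewrite J_independent ?iota_uniq// (big_nth j0) size_tuple /index_iota subn0.
rewrite -prodEFin; apply: eq_bigr => i _; rewrite -(J_law i).
by congr (P _); apply/seteqP; split=> w /=; rewrite inE => /eqP.
Qed.

Lemma expectation_history k (f : k.-tuple I -> R) : (forall t, 0 <= f t) ->
  ('E_P[f \o history k] =
   (\sum_(t : k.-tuple I) (\prod_(j <- t) prob j) * f t)%:E)%E.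
Proof.
move=> f_ge0; rewrite unlock.
transitivity (\int[P]_w \sum_(t : k.-tuple I)
    (f t)%:E * (\1_[set w | history k w = t]%classic w)%:E)%E.
  apply: eq_integral => w _; rewrite (bigD1 (history k w))//= big1 => [|t ht].
    by rewrite indicE mem_set// mule1 adde0.
  by rewrite indicE memNset ?mule0//= => /eqP; rewrite eq_sym (negPf ht).
rewrite ge0_integral_sum//; last 2 first.
- move=> t; apply: emeasurable_funM => //; apply/measurable_EFinP.
  by apply: measurable_indic; exact: measurable_history.
- by move=> t w _; rewrite mule_ge0// lee_fin.
rewrite -sumEFin; apply: eq_bigr => t _.
rewrite ge0_integralZl_EFin//; last first.
  by apply/measurable_EFinP; apply: measurable_indic; exact: measurable_history.
rewrite integral_indic//; last exact: measurable_history.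
by rewrite setIT EFinM muleC -history_law.
Qed.

Lemma sum_tuple_cons k (F : k.+1.-tuple I -> R) :
  \sum_t F t = \sum_j \sum_(t : k.-tuple I) F [tuple of j :: t].
Proof.
rewrite pair_bigA (reindex (fun p : I * k.-tuple I => [tuple of p.1 :: p.2]))//=.
exists (fun t => (thead t, [tuple of behead t])) => [[j t] _|t _] /=.
  by rewrite theadE; congr (_, _); apply: val_inj.
by rewrite -tuple_eta.
Qed.

Section Contraction.
Variables (S : Type) (step : I -> S -> S) (f : S -> R) (rho : R).
Hypothesis f_ge0 : forall s, 0 <= f s.
Hypothesis step_contraction :
  forall s, \sum_j prob j * f (step j s) <= rho * f s.

Lemma prob_ge0 j : 0 <= prob j.
Proof. by rewrite -lee_fin -(J_law 0) measure_ge0. Qed.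

(** Peeling the first index leaves the same sum started from [step j s], so the
    induction hypothesis is used at every [step j s]. *)
Lemma sum_histories_le k s :
  \sum_(t : k.-tuple I) (\prod_(j <- t) prob j) * f (foldl (fun s j => step j s) s t) <=
  rho ^+ k * f s.
Proof.
have rhof_ge0 s' : 0 <= rho * f s'.
  apply: le_trans (step_contraction s'); apply: sumr_ge0 => j _.
  by rewrite mulr_ge0 ?prob_ge0.
(* The contraction bounds [rho * f s'] below by [0]: if [rho < 0], then [f = 0]. *)
have [rho_ge0|rho_lt0] := leP 0 rho; last first.
  have f0 s' : f s' = 0.
    apply/eqP; rewrite eq_le f_ge0 andbT -(nmulr_rge0 _ rho_lt0); exact: rhof_ge0.
  by rewrite f0 mulr0 big1// => t _; rewrite f0 mulr0.
elim: k s => [|k IHk] s.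
  rewrite (big_pred1 [tuple]) => [|t]; last by rewrite [t]tuple0 /= eqxx.
  by rewrite big_nil expr0.
rewrite sum_tuple_cons.
apply: (@le_trans _ _ (\sum_j prob j * (rho ^+ k * f (step j s)))).
  apply: ler_sum => j _; apply: le_trans (ler_wpM2l (prob_ge0 j) (IHk _)).
  by rewrite mulr_sumr; apply: ler_sum => t _; rewrite big_cons mulrA.
under eq_bigr do rewrite mulrCA.
rewrite -mulr_sumr exprSr -mulrA; apply: ler_wpM2l; last exact: step_contraction.
exact: exprn_ge0.
Qed.

Lemma expectation_iteration_le (W : nat -> Omega -> S) (W0 : S) k :
  (forall w, W 0%N w = W0) ->
  (forall i w, W i.+1 w = step (J i w) (W i w)) ->
  ('E_P[fun w => f (W k w)] <= (rho ^+ k * f W0)%:E)%E.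
Proof.
move=> W_0 W_S.
have WE w : W k w = foldl (fun s j => step j s) W0 (history k w).
  have -> : tval (history k w) = [seq J i w | i <- iota 0 k].
    by rewrite /= -val_enum_ord -map_comp.
  elim: k => [|k IHk]; first exact: W_0.
  by rewrite W_S IHk -addn1 iotaD map_cat foldl_cat.
have -> : (fun w => f (W k w)) =
    (fun t : k.-tuple I => f (foldl (fun s j => step j s) W0 t)) \o history k.
  by apply/funext => w /=; rewrite WE.
by rewrite expectation_history// lee_fin sum_histories_le.
Qed.

End Contraction.
End RandomIteration.

(** * Convergence of the method *)

Theorem theorem2p2 (R : realType) (n1 n2 n p q : nat)
    (A : tensor R n1 n2 n.+1) (B : tensor R n1 p n.+1)
    (tau : 'I_q -> {set 'I_n2})
    (tau_neq0 : forall j, tau j != finset.set0)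
    (tau_disjoint : forall i j, i != j -> [disjoint tau i & tau j])
    (tau_cover : (\bigcup_(j < q) tau j)%SET = [set: 'I_n2]%SET)
    (A_full_col_rank : \rank (bcirc A) = (n2 * n.+1)%N)
    (XLS : tensor R n2 p n.+1) (XLS_min : least_squares A B XLS)
    (X0 : tensor R n2 p n.+1)
    (d : measure_display) (Omega : measurableType d) (P : probability Omega R)
    (J : nat -> Omega -> 'I_q)
    (X : nat -> Omega -> tensor R n2 p n.+1)
    (Res : nat -> Omega -> tensor R n1 p n.+1)
    (X_tRABCD : tRABCD A B tau X0 P J X Res) (k : nat) :
  ('E_P[fun w => normF2 (tprod A (XLS - X k.+1 w)%R)] <=
   ((1 - sigma_min (bcirc A) ^+ 2 / (Gamma1 A tau * normF2 A)) ^+ k.+1 *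
    normF2 (tprod A (XLS - X0)))%:E)%E.
Proof.
have n2_le_n1 : (n2 <= n1)%N.
  have := rank_leq_row (bcirc A).
  by rewrite A_full_col_rank sum_nat_const card_ord mulnC leq_mul2l.
have Res_eq i w : Res i w = B - tprod A (X i w).
  elim: i => [|i IHi].
    by rewrite (tRABCD_Res0 X_tRABCD) (tRABCD_X0 X_tRABCD).
  by have [] := tRABCD_step_error XLS_min IHi (tRABCD_iter X_tRABCD i w).
apply: (@expectation_iteration_le _ _ _ P _ J _ (tRABCD_measurable X_tRABCD)
  (tRABCD_independent X_tRABCD) (tRABCD_law X_tRABCD)
  _ (fun j => error_step A (tau j)) (fun W => normF2 (tprod A W)) _ _ _
  (fun i w => XLS - X i w)) => [W|W|w|i w].
- exact: normF2_ge0.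
- exact: expected_contraction.
- by rewrite (tRABCD_X0 X_tRABCD).
- by have [] := tRABCD_step_error XLS_min (Res_eq i w) (tRABCD_iter X_tRABCD i w).
Qed.
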